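(* Let $f$ be a multiplicative graph invariant and let $G=H_1\sqcup\cdots\sqcup H_k$ with $k\geq 1$. Let $I=\{i\in\{1,\dots,k\}: f(H_i)=0\}$ and $J=\{j\in\{1,\dots,k\}: vs_f(H_j)=\infty\}$. Then, the cases being read in order (the first applicable one is used): (1) if $J=\{1,\dots,k\}$, then $vs_f(G)=\infty$; (2) if $I\neq\emptyset$, then $vs_f(G)=\sum_{i\in I}\min\{vs_f(H_i),|V(H_i)|\}$; (3) otherwise, $vs_f(G)$ is the minimum of all the numbers $vs_f(H_i)$ with $i\in\{1,\dots,k\}\setminus J$ and all the numbers $|V(H_j)|$ with $j\in J$ and $f(H_j)\neq 1$.
   Context: All graphs are finite and simple (the graph with no vertices is allowed). An invariant is a function $f$ from graphs to $[0,\infty)$ that is constant on isomorphism classes. $\sqcup$ denotes disjoint union of graphs. $f$ is multiplicative if $f(H_1\sqcup H_2)=f(H_1)\cdot f(H_2)$ for all disjoint graphs $H_1,H_2$. The $f$-vertex stability number is $vs_f(G)=\min\{|X|: X\subseteq V(G),\ f(G-X)\neq f(G)\}$, and $vs_f(G)=\infty$ if $f(G-X)=f(G)$ for all $X\subseteq V(G)$ ($X=V(G)$ is allowed). *)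

(* Defs.v *)
From HB Require Import structures.
From mathcomp Require Import all_boot all_order all_algebra.
From mathcomp Require Import reals constructive_ereal.

Set Implicit Arguments.
Unset Strict Implicit.
Unset Printing Implicit Defensive.

Import Order.TTheory GRing.Theory Num.Theory.
Local Open Scope ring_scope.

Record sgraph := SGraph {
  vertex :> finType;
  adj : rel vertex;
  adj_sym : symmetric adj;
  adj_irrefl : irreflexive adj }.

Definition giso (G1 G2 : sgraph) : Prop :=
  exists2 h : G1 -> G2, bijective h & forall x y, adj (h x) (h y) = adj x y.

Section InducedSubgraph.
Variables (G : sgraph) (X : {set G}).

Definition gdel_adj : rel {x : G | x \notin X} :=
  fun u v => adj (val u) (val v).

Lemma gdel_sym : symmetric gdel_adj.
Proof. by move=> u v; apply: adj_sym. Qed.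

Lemma gdel_irrefl : irreflexive gdel_adj.
Proof. by move=> u; apply: adj_irrefl. Qed.

Definition gdel : sgraph := SGraph gdel_sym gdel_irrefl.

End InducedSubgraph.

Section DisjointUnion.
Variables G1 G2 : sgraph.

Definition gunion_adj : rel (G1 + G2) := fun u v =>
  match u, v with
  | inl x, inl y => adj x y
  | inr x, inr y => adj x y
  | _, _ => false
  end.

Lemma gunion_sym : symmetric gunion_adj.
Proof. by move=> [x|x] [y|y] //=; apply: adj_sym. Qed.

Lemma gunion_irrefl : irreflexive gunion_adj.
Proof. by move=> [x|x] /=; apply: adj_irrefl. Qed.

Definition gunion : sgraph := SGraph gunion_sym gunion_irrefl.

End DisjointUnion.

Section BigDisjointUnion.
Variables (k : nat) (H : 'I_k -> sgraph).

(* [tagged_as u v] is the vertex of [v] cast to the graph of [u]; it is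
   meaningful only when both vertices come from the same graph. *)
Definition gbigunion_adj : rel {i : 'I_k & H i} := fun u v =>
  (tag u == tag v) && adj (tagged u) (tagged_as u v).

Lemma gbigunion_sym : symmetric gbigunion_adj.
Proof.
move=> [i x] [j y]; rewrite /gbigunion_adj /=.
case: (eqVneq i j) => [eij | //]; case: j / eij y => y.
by rewrite !tagged_asE adj_sym.
Qed.

Lemma gbigunion_irrefl : irreflexive gbigunion_adj.
Proof.
by move=> [i x]; rewrite /gbigunion_adj eqxx tagged_asE /= adj_irrefl.
Qed.

Definition gbigunion : sgraph := SGraph gbigunion_sym gbigunion_irrefl.

End BigDisjointUnion.

Section Invariants.
Variable R : realType.
Implicit Type f : sgraph -> R.

Definition graph_invariant f : Prop :=
  (forall G, 0 <= f G) /\ (forall G1 G2, giso G1 G2 -> f G1 = f G2).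

Definition graph_multiplicative f : Prop :=
  forall G1 G2, f (gunion G1 G2) = f G1 * f G2.

(* Values lie in N u {+oo}, embedded in the extended integers (nat carries no
   order on [\bar nat]); the minimum over the empty family is +oo. *)
Definition vs f (G : sgraph) : \bar int :=
  \big[Order.min/+oo%E]_(X : {set G} | f (gdel X) != f G) (#|X|%:Z)%:E.

End Invariants.

(* Main.v *)
(* Deleting X from a disjoint union deletes its trace X_i from each component
   H_i, so f (G - X) is the product of the f (H_i - X_i).  If some f (H_i)
   vanishes, X changes f (G) = 0 exactly when every factor becomes nonzero,
   and the optimal deletions in the vanishing components add up.  If no f (H_i)
   vanishes, changing f (G) forces some factor to change, and changing a single
   factor suffices.  As soon as f is not identically zero, graphs without
   vertices have value 1, so vs_f (H) <= |V(H)| whenever f (H) <> 1: the minima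
   with |V(H_i)| in the second case are attained by vs_f (H_i), and the second
   family of the third case is empty. *)
Require Import Defs.
From HB Require Import structures.
From mathcomp Require Import all_boot all_order all_algebra.
From mathcomp Require Import reals constructive_ereal.

Set Implicit Arguments.
Unset Strict Implicit.
Unset Printing Implicit Defensive.

Import Order.TTheory GRing.Theory Num.Theory.
Local Open Scope ring_scope.

(** * Isomorphisms for empty deletions and disjoint unions *)

Section Isomorphisms.

(** Finite choice extracts an inverse from surjectivity, so later isomorphisms need not define one
    by hand. *)
Lemma giso_of_inj_surj (G1 G2 : sgraph) (h : G1 -> G2) :
    injective h -> (forall y, exists x, h x = y) ->
    (forall x y, adj (h x) (h y) = adj x y) ->
  giso G1 G2.
Proof.
move=> h_inj h_surj h_adj; exists h => //.
have [g hg] := fin_all_exists h_surj.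
by exists g => // x; apply: h_inj.
Qed.

Lemma giso_gdel0 (G : sgraph) : giso (gdel (set0 : {set G})) G.
Proof.
apply: (@giso_of_inj_surj (gdel set0) G val) => //; first exact: val_inj.
move=> y; have y0 : y \notin (set0 : {set G}) by rewrite inE.
by exists (Sub y y0).
Qed.

Lemma giso_gunion_empty (G E : sgraph) : #|E| = 0%N -> giso G (gunion G E).
Proof.
move=> E0; apply: (@giso_of_inj_surj G (gunion G E) inl) => //.
  by move=> x y [].
by case=> [x|e]; [exists x | have := fintype0 e E0].
Qed.

Lemma giso_gbigunionS (k : nat) (H : 'I_k.+1 -> sgraph) :
  giso (gunion (H ord0) (gbigunion (fun i => H (lift ord0 i)))) (gbigunion H).
Proof.
pose h (u : gunion (H ord0) (gbigunion (fun i => H (lift ord0 i)))) :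
    gbigunion H :=
  match u with
  | inl x => Tagged H x
  | inr v => Tagged H (tagged v)
  end.
apply: (@giso_of_inj_surj _ _ h).
- move=> [x|[i x]] [y|[j y]] //= e.
  + by congr inl; apply: (eq_from_Tagged (T_ := H)) e.
  + have ij : i = j.
      by apply: (@lift_inj _ ord0); have := congr1 tag e.
    by case: j / ij y e => y /(eq_from_Tagged (T_ := H)) ->.
- move=> [j x]; case: (unliftP ord0 j) x => [i ->|->] x.
    by exists (inr (Tagged (fun i => H (lift ord0 i)) x)).
  by exists (inl x).
- move=> [x|[i x]] [y|[j y]] //=; rewrite /adj /= /gbigunion_adj /=.
  + by rewrite tagged_asE.
  + rewrite (inj_eq lift_inj).
    case: (eqVneq i j) => [ij|//] /=; case: j / ij y => y.
    by rewrite !tagged_asE.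
Qed.

End Isomorphisms.

(** * Traces of a vertex set on the components of a disjoint union *)

Section Slices.
Variables (k : nat) (H : 'I_k -> sgraph).
Implicit Type X : {set gbigunion H}.

Definition slice X (i : 'I_k) : {set H i} := [set x | Tagged H x \in X].

Lemma card_slices X : #|X| = (\sum_i #|slice X i|)%N.
Proof.
rewrite -sum1_card.
under [RHS]eq_bigr => i _ do rewrite -sum1_card.
rewrite sig_big_dep /=.
by apply: eq_bigl => -[i x]; rewrite inE.
Qed.

Lemma slice_imset_eq (i : 'I_k) (Y : {set H i}) :
  slice ([set Tagged H x | x in Y] : {set gbigunion H}) i = Y.
Proof.
apply/setP => x; rewrite inE; apply/imsetP/idP => [[y yY]|xY].
  by move=> /(eq_from_Tagged (T_ := H)) ->.
by exists x.
Qed.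

Lemma slice_imset_neq (i j : 'I_k) (Y : {set H i}) : j != i ->
  slice ([set Tagged H x | x in Y] : {set gbigunion H}) j = set0.
Proof.
move=> ji; apply/setP => x; rewrite !inE; apply/imsetP => -[y _ e].
by have := congr1 tag e => /= /eqP; apply/negP.
Qed.

Lemma card_imset_Tagged (i : 'I_k) (Y : {set H i}) :
  #|([set Tagged H x | x in Y] : {set gbigunion H})| = #|Y|.
Proof.
by apply: card_imset => x y; apply: eq_from_Tagged.
Qed.

(** Both sides have the same tagged vertices; only the proof of non-membership moves, from the
    component vertex to the tagged pair. *)
Lemma giso_gdel_gbigunion X :
  giso (gbigunion (fun i => gdel (slice X i))) (gdel X).
Proof.
have hP (u : gbigunion (fun i => gdel (slice X i))) :
    Tagged H (val (tagged u)) \notin X.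
  by have := valP (tagged u); rewrite inE.
pose h (u : gbigunion (fun i => gdel (slice X i))) : gdel X :=
  Sub (Tagged H (val (tagged u))) (hP u).
apply: (@giso_of_inj_surj _ _ h).
- move=> [i x] [j y] /(congr1 val) /= e.
  have ij : i = j by have := congr1 tag e.
  case: j / ij y e => y /(eq_from_Tagged (T_ := H)) e.
  by congr existT; apply: val_inj.
- move=> [[i x] xX].
  have xS : x \notin slice X i by rewrite inE.
  exists (Tagged (fun i => gdel (slice X i)) (Sub x xS : gdel (slice X i))).
  exact: val_inj.
- move=> [i x] [j y]; rewrite /adj /= /gdel_adj /adj /= /gbigunion_adj /=.
  case: (eqVneq i j) => [ij|//] /=; case: j / ij y => y.
  by rewrite !tagged_asE.
Qed.

End Slices.

(** * Vertex stability under a multiplicative invariant *)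

Section VertexStability.
Variables (R : realType) (f : sgraph -> R).

Lemma vs_le (G : sgraph) (X : {set G}) :
  f (gdel X) != f G -> (vs f G <= (#|X|%:Z)%:E)%E.
Proof. by move=> fX; apply: bigmin_le_cond. Qed.

Lemma le_vs (G : sgraph) (v : \bar int) :
    (forall X : {set G}, f (gdel X) != f G -> (v <= (#|X|%:Z)%:E)%E) ->
  (v <= vs f G)%E.
Proof. by move=> vX; apply: le_bigmin => //; apply: leey. Qed.

(** [Order.min] returns one of its arguments, so the iterated minimum is either its default [+oo] or
    one of the listed sizes. *)
Lemma vs_attained (G : sgraph) : vs f G != +oo%E ->
  exists2 X : {set G}, f (gdel X) != f G & vs f G = (#|X|%:Z)%:E.
Proof.
rewrite /vs; apply: (big_ind (fun v => v != +oo%E -> exists2 X : {set G},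
  f (gdel X) != f G & v = (#|X|%:Z)%:E)) => [|v w vP wP|X fX _].
- by rewrite eqxx.
- by rewrite /Order.min; case: ifP.
- by exists X.
Qed.

Lemma vs_eq_oo (G : sgraph) :
  vs f G = +oo%E <-> forall X : {set G}, f (gdel X) = f G.
Proof.
split=> [vsG X|fX].
  by apply/eqP/negPn/negP => /vs_le; rewrite vsG.
apply/eqP; rewrite -[_ == _]negbK; apply/negP => /vs_attained[X].
by rewrite fX eqxx.
Qed.

Hypotheses (f_inv : graph_invariant f) (f_mul : graph_multiplicative f).

Lemma invariant_giso (G1 G2 : sgraph) : giso G1 G2 -> f G1 = f G2.
Proof. by case: f_inv => _; apply. Qed.

Lemma invariant_gdel0 (G : sgraph) : f (gdel (set0 : {set G})) = f G.
Proof. exact/invariant_giso/giso_gdel0. Qed.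

Lemma multiplicative_empty (G E : sgraph) : #|E| = 0%N -> f G * f E = f G.
Proof.
by move=> E0; rewrite -f_mul -(invariant_giso (giso_gunion_empty G E0)).
Qed.

Lemma multiplicative_gdelT (G K : sgraph) :
  f K != 0 -> f (gdel [set: G]) = 1.
Proof.
move=> fK; apply: (mulfI fK); rewrite mulr1 multiplicative_empty //.
by apply: eq_card0 => -[x xT]; have := xT; rewrite in_setT.
Qed.

(** The induction starts at one component: the empty product is 1, whereas a graph without vertices
    has value 0 when [f] is identically zero. *)
Lemma multiplicative_gbigunion (k : nat) (H : 'I_k -> sgraph) :
  (1 <= k)%N -> f (gbigunion H) = \prod_i f (H i).
Proof.
case: k H => // k H _; elim: k H => [|k IHk] H;
  rewrite -(invariant_giso (giso_gbigunionS H)) f_mul big_ord_recl.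
  rewrite big_ord0 mulr1 multiplicative_empty //.
  by apply: eq_card0 => -[[]].
by rewrite IHk.
Qed.

Lemma multiplicative_gdel_gbigunion (k : nat) (H : 'I_k -> sgraph)
    (X : {set gbigunion H}) :
  (1 <= k)%N -> f (gdel X) = \prod_i f (gdel (slice X i)).
Proof.
move=> k_ge1; rewrite -(invariant_giso (giso_gdel_gbigunion X)).
exact: multiplicative_gbigunion.
Qed.

Lemma gdel_gbigunion_neq (k : nat) (H : 'I_k -> sgraph)
    (X : {set gbigunion H}) :
    (1 <= k)%N -> f (gdel X) != f (gbigunion H) ->
  exists i, f (gdel (slice X i)) != f (H i).
Proof.
move=> k_ge1; rewrite multiplicative_gdel_gbigunion //.
rewrite multiplicative_gbigunion // => fX; apply/existsP.
rewrite -[X in is_true X]negbK negb_exists.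
apply/negP => /forallP fXi; case/eqP: fX.
by apply: eq_bigr => i _; apply/eqP; rewrite -[_ == _]negbK.
Qed.

(* The hypothesis on K only serves to exclude f = 0. *)
Lemma vs_le_card (G K : sgraph) :
  vs f K != +oo%E -> f G != 1 -> (vs f G <= (#|G|%:Z)%:E)%E.
Proof.
move=> vsK fG1.
(* If [f K = 0], a deletion that changes this value leaves a graph of nonzero value. *)
have [L fL] : exists L, f L != 0.
  have [X fX _] := vs_attained vsK.
  have [K0|K_neq0] := eqVneq (f K) 0; last by exists K.
  by exists (gdel X); rewrite -K0.
by rewrite -cardsT; apply: vs_le; rewrite (multiplicative_gdelT G fL) eq_sym.
Qed.

Section Gbigunion.
Variables (k : nat) (H : 'I_k -> sgraph).
Hypothesis k_ge1 : (1 <= k)%N.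

Lemma vs_gbigunion_oo :
  (forall i, vs f (H i) = +oo%E) -> vs f (gbigunion H) = +oo%E.
Proof.
move=> vsH; apply/vs_eq_oo => X; apply/eqP/negPn/negP.
by move=> /(gdel_gbigunion_neq k_ge1)[i]; rewrite (vs_eq_oo _).1 ?eqxx.
Qed.

(** The graph [K] rules out [f = 0], for which the left side is [+oo] and the right side finite. *)
Lemma vs_gbigunion_zero (K : sgraph) :
    vs f K != +oo%E -> (exists i, f (H i) = 0) ->
  vs f (gbigunion H) =
    (\sum_(i | f (H i) == 0%R) Order.min (vs f (H i)) (#|H i|%:Z)%:E)%E.
Proof.
move=> vsK [i0 fi0].
have fG : f (gbigunion H) = 0.
  by rewrite multiplicative_gbigunion // (bigD1 i0) //= fi0 mul0r.
have vs_card i : f (H i) = 0 -> (vs f (H i) <= (#|H i|%:Z)%:E)%E.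
  by move=> fi; apply: vs_le_card vsK _; rewrite fi eq_sym oner_eq0.
(* [Y i] is an optimal deletion in a vanishing component and empty elsewhere, so every remaining
   factor is nonzero. *)
have /fin_all_exists[Y YP] i : exists Y : {set H i}, f (gdel Y) != 0 /\
    if f (H i) == 0 then vs f (H i) = (#|Y|%:Z)%:E else Y = set0.
  case: eqVneq => [fi|fi]; last by exists set0; rewrite invariant_gdel0.
  have [Y fY vsY] : exists2 Y : {set H i},
      f (gdel Y) != f (H i) & vs f (H i) = (#|Y|%:Z)%:E.
    by apply: vs_attained; apply: contraTneq (vs_card i fi) => ->.
  by exists Y; rewrite -[X in _ != X]fi.
have -> : (\sum_(i | f (H i) == 0%R) Order.min (vs f (H i)) (#|H i|%:Z)%:E)%E
    = ((\sum_(i | f (H i) == 0%R) #|Y i|)%N%:Z)%:E.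
  rewrite -natz natr_sum -sumEFin; apply: eq_bigr => i fi.
  have [_] := YP i; rewrite fi => vsY.
  by rewrite min_l ?vs_card ?(eqP fi) // vsY natz.
apply/eqP; rewrite eq_le; apply/andP; split.
  pose X : {set gbigunion H} := [set u | tagged u \in Y (tag u)].
  have sX i : slice X i = Y i by apply/setP => x; rewrite !inE.
  have -> : (\sum_(i | f (H i) == 0%R) #|Y i| = #|X|)%N.
    rewrite card_slices big_mkcond; apply: eq_bigr => i _; rewrite sX.
    by have [_] := YP i; case: ifP => // _ ->; rewrite cards0.
  apply: vs_le; rewrite fG multiplicative_gdel_gbigunion // prodf_seq_neq0.
  by apply/allP => i _ /=; rewrite sX (YP i).1.
(* A nonzero product has nonzero factors, so each slice in a vanishing component changes its value
   and has at least [#|Y i|] vertices. *)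
apply: le_vs => X; rewrite fG multiplicative_gdel_gbigunion // => fX.
rewrite lee_fin lez_nat card_slices big_mkcond leq_sum // => i _.
case: ifP => // fi; have [_] := YP i; rewrite fi => vsY.
rewrite -lez_nat -lee_fin -vsY vs_le // (eqP fi).
by move/prodf_neq0: fX; apply.
Qed.

Lemma vs_gbigunion_nonzero : (forall i, f (H i) != 0) ->
  vs f (gbigunion H) =
    (\big[Order.min/+oo]_(i | vs f (H i) != +oo) vs f (H i))%E.
Proof.
move=> fH; apply/eqP; rewrite eq_le; apply/andP; split.
  (* An optimal deletion in one component changes one factor; the others are unchanged and nonzero,
     hence cancel. *)
  apply: le_bigmin => [|i vsi]; first exact: leey.
  have [Y fY ->] := vs_attained vsi.
  rewrite -card_imset_Tagged; apply: vs_le.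
  rewrite multiplicative_gdel_gbigunion // multiplicative_gbigunion //.
  rewrite (bigD1 i) //= [X in _ != X](bigD1 i) //= slice_imset_eq.
  rewrite (eq_bigr (fun j => f (H j))) => [|j ji]; last first.
    by rewrite slice_imset_neq // invariant_gdel0.
  rewrite (inj_eq (mulIf _)) //.
  by apply/prodf_neq0 => j _; apply: fH.
(* Conversely, some slice of [X] changes its factor, and it is no larger than [X]. *)
apply: le_vs => X /(gdel_gbigunion_neq k_ge1)[i fXi].
have vsX := vs_le fXi.
have vsi : vs f (H i) != +oo%E by apply: contraTneq vsX => ->.
apply: le_trans (le_trans _ vsX) _; first exact: bigmin_le_cond.
by rewrite lee_fin lez_nat card_slices (bigD1 i) //= leq_addr.
Qed.

End Gbigunion.
End VertexStability.

Theorem theorem2p5 (R : realType) (f : sgraph -> R) (k : nat)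
    (H : 'I_k -> sgraph)
    (f_inv : graph_invariant f) (f_mul : graph_multiplicative f)
    (k_ge1 : (1 <= k)%N) :
  let G := gbigunion H in
  let I := [set i : 'I_k | f (H i) == 0] in
  let J := [set j : 'I_k | vs f (H j) == +oo%E] in
  [/\ J = [set: 'I_k] -> vs f G = +oo%E,
      J <> [set: 'I_k] -> I <> set0 ->
        vs f G = (\sum_(i in I) Order.min (vs f (H i)) (#|H i|%:Z)%:E)%E
    & J <> [set: 'I_k] -> I = set0 ->
        vs f G =
          Order.min
            (\big[Order.min/+oo%E]_(i in ~: J) vs f (H i))
            (\big[Order.min/+oo%E]_(j in J | f (H j) != 1) (#|H j|%:Z)%:E)].
Proof.
move=> G I J.
have exJ : J <> setT -> exists j, vs f (H j) != +oo%E.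
  move=> /eqP; rewrite -subTset => /subsetPn[j _].
  by rewrite inE => vsj; exists j.
split=> [JT|/exJ[j vsj] I0|/exJ[j vsj] I0].
- apply: vs_gbigunion_oo => // i.
  by apply/eqP; have := in_setT i; rewrite -JT inE.
- rewrite (vs_gbigunion_zero f_inv f_mul k_ge1 vsj).
    by apply: eq_bigl => i; rewrite inE.
  by case/eqP/set0Pn: I0 => i; rewrite inE => /eqP fi; exists i.
(* An index of the second family would give [+oo] at most [#|H i|]; the empty minimum is [+oo],
   neutral for [Order.min]. *)
- rewrite [X in Order.min _ X]big_pred0 => [|i]; last first.
    apply/negP => /andP[]; rewrite inE => /eqP vsi fi.
    by have := vs_le_card f_inv f_mul vsj fi; rewrite vsi.
  rewrite min_l ?leey // vs_gbigunion_nonzero // => [|i].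
    by apply: eq_bigl => i; rewrite !inE.
  by have := in_set0 i; rewrite -I0 inE => ->.
Qed.
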